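(* (Penalty only competition.) Suppose party $\mathcal A$ punishes the uniquely least supportive group ($\chi_A>0$, $\chi_B=0$), there are no prizes ($\zeta_A=0$ and $\zeta_B=0$), voting is costly ($c>0$), and there are no policy differences ($G(x)=0$ for $x<0$ and $G(x)=1$ for $x\ge0$, i.e. all voters have $\varepsilon_i=0$). Let $\overline\lambda=\max_{1\le i\le K}n_ip_i$. Then in any Nash equilibrium either (i) no groups support $\mathcal A$: $p_i=0$ for all $i\in\{1,\dots,K\}$; or (ii) all groups support $\mathcal A$: $p_i>0$ for all $i\in\{1,\dots,K\}$, and for each group $j$ either $p_jn_j=\overline\lambda$ or ($n_j<\overline\lambda$ and $p_j=1$).
   Context: Two parties $\mathcal A,\mathcal B$ compete in an election. Voters are divided into $K\ge2$ groups; the size of group $k$ is Poisson with mean $n_k>0$, independently across groups. Each voter votes for $\mathcal A$, votes for $\mathcal B$, or abstains; voting costs $c$. Voter $i$ gets policy payoff $\varepsilon_i$ if $\mathcal A$ wins and $0$ otherwise, with $\varepsilon_i$ i.i.d. with distribution function $G$. Each member of a group gains $\zeta_A$ (resp. $\zeta_B$) if the group is awarded the prize of $\mathcal A$ (resp. $\mathcal B$), and loses $\chi_A$ (resp. $\chi_B$) if the group is punished by $\mathcal A$ (resp. $\mathcal B$). $p_k$ and $q_k$ denote the probabilities that a member of group $k$ votes for $\mathcal A$ and $\mathcal B$. From the perspective of any voter, the numbers of votes for $\mathcal A$ of the other voters in groups $1,\dots,K$ are independent Poisson variables $A_1,\dots,A_K$ with means $n_1p_1,\dots,n_Kp_K$.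 Punishment rule: $\mathcal A$ punishes group $k$ if and only if its number of votes for $\mathcal A$ is strictly less than that of every other group. The penalty pivot $QP_{A,k}$ is the probability that group $k$ is punished if a given member of $k$ votes for $\mathcal A$ (vote counts $A_k+1$ and $A_i$, $i\ne k$) minus that probability if she abstains (vote counts $A_1,\dots,A_K$). In this setting a voter in group $k$ gets, relative to abstaining, expected utility $-\chi_AQP_{A,k}-c$ from voting for $\mathcal A$ and $-c$ from voting for $\mathcal B$. Equilibria are type-symmetric (all members of a group use the same, possibly mixed, strategy): a profile $(p_k,q_k)_k$ is a Nash equilibrium if in each group $k$ every action played with positive probability maximizes expected utility; equivalently $q_k=0$ and $-\chi_AQP_{A,k}\le c$ if $p_k=0$, $-\chi_AQP_{A,k}=c$ if $p_k\in(0,1)$, $-\chi_AQP_{A,k}\ge c$ if $p_k=1$. *)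

(* Defs.v *)
From HB Require Import structures.
From mathcomp Require Import all_boot all_order all_algebra.
From mathcomp Require Import all_classical all_reals all_analysis.

Set Implicit Arguments.
Unset Strict Implicit.
Unset Printing Implicit Defensive.

Import Order.TTheory GRing.Theory Num.Theory.

Local Open Scope classical_set_scope.
Local Open Scope ring_scope.

(** MathComp-Analysis.  The [K] groups are indexed by ['I_K]. *)

Inductive action := VoteA | VoteB | Abstain.

Section Votes.
Context {d : measure_display} {T : measurableType d} {R : realType}.
Variables (P : probability T R) (K : nat).
Implicit Types (A : 'I_K -> {RV P >-> nat}) (a : 'I_K -> nat) (k : 'I_K).

Definition mutually_independent A : Prop :=
  forall (J : {set 'I_K}) (B : 'I_K -> set nat),
    P (\bigcap_(i in [set` J]) (A i @^-1` B i)) =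
    (\prod_(i in J) P (A i @^-1` B i))%E.

(** The second argument [0%N] of [poisson_prob] is a dummy of the library's
    definition.  For rate [0] the library's [poisson_prob] is the Dirac mass
    at [0], as it should be here since [p k = 0] is allowed. *)
Definition poisson_votes (n p : 'I_K -> R) A : Prop :=
  (forall k (U : set nat),
     distribution P (A k) U = poisson_prob (n k * p k) 0%N U) /\
  mutually_independent A.

Definition punished a k : bool := [forall i, (i != k) ==> (a k < a i)%N].

Definition extra_vote a k : 'I_K -> nat := fun i => (a i + (i == k))%N.

(** [A] counts the votes for the punishing party cast by the other voters. *)
Definition penalty_pivot A k : R :=
  fine (P [set w | punished (extra_vote (fun i => A i w) k) k]) -
  fine (P [set w | punished (fun i => A i w) k]).

(** Expected utility relative to abstaining.  With no prizes, no punishment by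
    the other party and identically zero policy payoffs, only the penalty
    [chiA] and the voting cost [c] remain. *)
Definition expected_utility (chiA c : R) A k (s : action) : R :=
  match s with
  | VoteA => - chiA * penalty_pivot A k - c
  | VoteB => - c
  | Abstain => 0
  end.

Definition play_prob (p q : 'I_K -> R) k (s : action) : R :=
  match s with
  | VoteA => p k
  | VoteB => q k
  | Abstain => 1 - p k - q k
  end.

(** A type-symmetric mixed profile in which every action played with positive
    probability is a best reply.  [A] must have the law induced by the profile,
    i.e. [poisson_votes n p A]. *)
Definition nash_equilibrium (chiA c : R) A (p q : 'I_K -> R) : Prop :=
  (forall k s, 0 <= play_prob p q k s) /\
  (forall k s, 0 < play_prob p q k s ->
     forall s', expected_utility chiA c A k s' <= expected_utility chiA c A k s).

End Votes.

(** The base value [0] is harmless: it is used for nonnegative means only. *)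
Definition max_mean {R : realType} (K : nat) (n p : 'I_K -> R) : R :=
  \big[Num.max/0]_(i < K) (n i * p i).

(* Main.v *)
Require Import Defs.
From HB Require Import structures.
From mathcomp Require Import all_boot all_order all_algebra.
From mathcomp Require Import all_classical all_reals all_analysis.
From mathcomp Require Import ring.

Set Implicit Arguments.
Unset Strict Implicit.
Unset Printing Implicit Defensive.

Import Order.TTheory GRing.Theory Num.Theory.

Local Open Scope ring_scope.

(** Write [lam k = n k * p k], and let [D k] be the probability that one more
    vote for the party saves group [k] from the penalty: [k] is uniquely least
    supportive as things stand and no longer is with the extra vote.  Then
    [D k] is minus the penalty pivot, so a vote for the party is worth
    [chiA * D k - c].  Votes for the other party only cost [c], hence [q = 0],
    and equilibrium says [c <= chiA * D k] when [0 < p k] and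
    [chiA * D k <= c] when [p k < 1].

    If some group [j] does not vote, [A j] vanishes almost surely, so another
    group [k] is never strictly below [j] and [D k = 0]
    ([averts_penalty_support]).  Voting in [k] then cannot pay, so either
    nobody supports the party or every group does.

    In the second case, suppose [lam j < lam k] where [lam k] is maximal.  The
    heart of the proof is that [D k < D j] ([averts_penalty_lt]): the group
    with the smaller mean is more likely to need the vote.  Fix [m < l].  Given
    that the group in danger has [m] votes and its rival [l], the conditional
    probability [aversion_weight] that the vote matters depends only on the
    other groups, hence is the same whether [j] or [k] is the one in danger.
    The probabilities of the two configurations compare as
    [lam k ^ m * lam j ^ l <= lam j ^ m * lam k ^ l], which is
    [poisson_pmf_swap], strictly so at [m = 0], [l = 1].  Summing over
    [(m, l)] gives the claim.  Now [p j < 1] would give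
    [chiA * D j <= c <= chiA * D k], a contradiction; so [p j = 1], and
    [n j = lam j] is below the maximal mean. *)

(** * Poisson masses *)

Lemma poisson_prob_set1 (R : realType) (r : R) (m : nat) :
  0 < r -> poisson_prob r 0%N [set m]%classic = (poisson_pmf r m)%:E.
Proof.
by move=> r0; rewrite /poisson_prob r0 esum_set1// lee_fin poisson_pmf_ge0.
Qed.

(** The factorials and exponentials agree on both sides; what remains is
    [s ^ m * r ^ l <= r ^ m * s ^ l], that is [r ^ (l - m) <= s ^ (l - m)]. *)
Lemma poisson_pmf_swap (R : realType) (r s : R) (m l : nat) :
  0 < r -> r <= s -> (m <= l)%N ->
  poisson_pmf s m * poisson_pmf r l <= poisson_pmf r m * poisson_pmf s l.
Proof.
move=> r0 rs ml; have s0 := lt_le_trans r0 rs.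
rewrite /poisson_pmf r0 s0.
set a := _^-1; set b := expR _; set a' := _^-1; set b' := expR _.
have -> : s ^+ m * a * b * (r ^+ l * a' * b') =
          a * a' * b * b' * (s ^+ m * r ^+ l) by ring.
have -> : r ^+ m * a * b' * (s ^+ l * a' * b) =
          a * a' * b * b' * (r ^+ m * s ^+ l) by ring.
apply: ler_wpM2l.
  by rewrite !mulr_ge0 ?invr_ge0 ?expR_ge0.
rewrite -(subnKC ml) !exprD mulrCA ler_wpM2l ?exprn_ge0 ?(ltW r0)//.
by rewrite ler_wpM2l ?exprn_ge0 ?(ltW s0)// lerXn2r// nnegrE ltW.
Qed.

Lemma poisson_pmf_swap01 (R : realType) (r s : R) : 0 < r -> r < s ->
  poisson_pmf s 0 * poisson_pmf r 1 < poisson_pmf r 0 * poisson_pmf s 1.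
Proof.
move=> r0 rs; have s0 := lt_trans r0 rs.
rewrite /poisson_pmf r0 s0 !fact0 !expr0 !expr1 factS fact0 !mul1n invr1 !mul1r !mulr1.
by rewrite mulrCA [ltRHS]mulrCA [X in _ < _ * X]mulrC ltr_pM2r ?mulr_gt0 ?expR_gt0.
Qed.

(** * Comparing two events fiber by fiber *)

Section compare.
Context {d : measure_display} {T : measurableType d} {R : realType}.

Lemma bigcup_fibers (Z : T -> nat) (U : set T) :
  (\bigcup_n (U `&` Z @^-1` [set n]) = U)%classic.
Proof. by apply/seteqP; split => [w [n _ []]//|w Uw]; exists (Z w). Qed.

(** The two events may be cut along different maps: this is what allows the
    roles of two groups to be exchanged in the comparison. *)
Lemma le_measure_fibers (mu : {measure set T -> \bar R}) (X Y : T -> nat)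
    (V W : set T) :
  (forall n, measurable (V `&` X @^-1` [set n])%classic) ->
  (forall n, measurable (W `&` Y @^-1` [set n])%classic) ->
  (forall n, mu (V `&` X @^-1` [set n])%classic <=
             mu (W `&` Y @^-1` [set n])%classic)%E ->
  (mu V <= mu W)%E.
Proof.
move=> mV mW leVW; rewrite -(bigcup_fibers X V) -(bigcup_fibers Y W).
rewrite !measure_bigcup//.
- by apply: lee_nneseries => n _; rewrite ?leVW ?measure_ge0.
- by move=> m n _ _ [w [[_ <-] [_ <-]]].
- by move=> m n _ _ [w [[_ <-] [_ <-]]].
Qed.

Lemma lt_measure_fibers (mu : {finite_measure set T -> \bar R})
    (X Y : T -> nat) (V W : set T) (n0 : nat) :
  (forall n, measurable (V `&` X @^-1` [set n])%classic) ->
  (forall n, measurable (W `&` Y @^-1` [set n])%classic) ->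
  (forall n, mu (V `&` X @^-1` [set n])%classic <=
             mu (W `&` Y @^-1` [set n])%classic)%E ->
  (mu (V `&` X @^-1` [set n0])%classic < mu (W `&` Y @^-1` [set n0])%classic)%E ->
  (mu V < mu W)%E.
Proof.
move=> mV mW leVW lt0.
have measurable_fibers (Z : T -> nat) (U : set T) :
    (forall n, measurable (U `&` Z @^-1` [set n])%classic) -> measurable U.
  by move=> mU; rewrite -(bigcup_fibers Z U); exact: bigcupT_measurable.
have split0 (Z : T -> nat) (U : set T) :
    (forall n, measurable (U `&` Z @^-1` [set n])%classic) ->
    mu U = (mu (U `&` Z @^-1` [set n0])%classic +
            mu (U `\` (U `&` Z @^-1` [set n0]))%classic)%E.
  move=> mU; have mUU := measurable_fibers _ _ mU.
  by rewrite addeC [LHS](measureDI _ mUU (mU n0)) setIA setIid.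
have rest (Z : T -> nat) (U : set T) n :
    ((U `\` (U `&` Z @^-1` [set n0])) `&` Z @^-1` [set n] =
     if n == n0 then set0 else U `&` Z @^-1` [set n])%classic.
  apply/seteqP; split => [w [[Uw nZ] /= Zn]|w].
    case: eqP => [nn|_]; last by split.
    by apply: nZ; split => //=; rewrite Zn nn.
  case: eqP => // nn [Uw /= Zn]; split => //; split => // -[_ /= Zn0].
  by apply: nn; rewrite -Zn -Zn0.
rewrite (split0 X V mV) (split0 Y W mW); apply: lte_leD => //.
  by apply: fin_num_measure; apply: measurableD => //; apply: measurable_fibers mV.
apply: (le_measure_fibers (X := X) (Y := Y)) => n; rewrite !rest;
  by case: ifP => // _; exact: leVW.
Qed.

End compare.

(** * The event that a vote averts the penalty *)

Section pivot.
Context {d : measure_display} {T : measurableType d} {R : realType}.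
Variables (P : probability T R) (K : nat) (A : 'I_K -> {RV P >-> nat}).
Implicit Types (j k : 'I_K) (e m l r : nat).

Local Open Scope classical_set_scope.

(** The extra votes [e] of group [k] make the same event serve the voter who
    abstains ([e = 0]) and the one who votes ([e = 1]). *)
Definition uniquely_least e k : set T :=
  [set w | forall i, i != k -> (A k w + e < A i w)%N].

Definition averts_penalty k : set T := uniquely_least 0 k `\` uniquely_least 1 k.

Definition others_at_least j k r : set T :=
  \bigcap_(i in [set` ~: [set j; k]%SET]) A i @^-1` [set x | (r <= x)%N].

Lemma measurable_votes k (U : set nat) : measurable (A k @^-1` U).
Proof. exact: measurable_funPTI. Qed.
Hint Resolve measurable_votes : core.

Lemma measurable_uniquely_least e k : measurable (uniquely_least e k).
Proof.
have -> : uniquely_least e k = \bigcup_m (A k @^-1` [set m] `&`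
    \bigcap_(i in [set` [set~ k]%SET]) A i @^-1` [set x | (m + e < x)%N]).
  apply/seteqP; split => [w lw|w [m _ [/= Am lw]] i ik].
    by exists (A k w) => //; split => // i /=; rewrite !inE; exact: lw.
  by rewrite Am; apply: lw; rewrite /= !inE.
apply: bigcupT_measurable => m; apply: measurableI => //.
by apply: fin_bigcap_measurable.
Qed.
Hint Resolve measurable_uniquely_least : core.

Lemma measurable_averts_penalty k : measurable (averts_penalty k).
Proof. exact: measurableD. Qed.

Lemma measurable_others_at_least j k r : measurable (others_at_least j k r).
Proof. exact: fin_bigcap_measurable. Qed.
Hint Resolve measurable_averts_penalty measurable_others_at_least : core.

Lemma uniquely_least_decr k : uniquely_least 1 k `<=` uniquely_least 0 k.
Proof. by move=> w lw i /lw; rewrite addn1 addn0; apply: ltnW. Qed.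

Lemma probability_averts_penalty k :
  fine (P (averts_penalty k)) = - penalty_pivot A k.
Proof.
rewrite /penalty_pivot opprB.
have -> : [set w | punished (fun i => A i w) k] = uniquely_least 0 k.
  apply/seteqP; split => [w /forallP lw i ik|w lw].
    by have := lw i; rewrite ik addn0.
  by apply/forallP => i; apply/implyP => /lw; rewrite addn0.
have -> : [set w | punished (extra_vote (fun i => A i w) k) k] = uniquely_least 1 k.
  apply/seteqP; split => [w /forallP lw i ik|w lw].
    by have := lw i; rewrite /extra_vote ik eqxx (negbTE ik) addn0.
  apply/forallP => i; apply/implyP => ik.
  by have := lw i ik; rewrite /extra_vote eqxx (negbTE ik) addn0.
rewrite measureD//; last by rewrite -ge0_fin_numE ?fin_num_measure.
by rewrite (setIidr (@uniquely_least_decr k)) fineB ?fin_num_measure.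
Qed.

Hypothesis indep : mutually_independent A.

(** Independence, in the only form needed: two distinguished groups are
    separated from each other and from the joint event on all the others. *)
Lemma probability_split2 j k (U V : set nat) r : j != k ->
  P (A j @^-1` U `&` (A k @^-1` V `&` others_at_least j k r)) =
  (P (A j @^-1` U) * (P (A k @^-1` V) * P (others_at_least j k r)))%E.
Proof.
move=> jk; pose B i := if i == j then U else if i == k then V
                       else [set x | (r <= x)%N].
have Bj : B j = U by rewrite /B eqxx.
have Bk : B k = V by rewrite /B eq_sym (negbTE jk) eqxx.
have Bo i : i \notin [set j; k]%SET -> B i = [set x | (r <= x)%N].
  by rewrite !inE negb_or /B => /andP[/negbTE -> /negbTE ->].
have -> : A j @^-1` U `&` (A k @^-1` V `&` others_at_least j k r) =
          \bigcap_(i in [set` [set: 'I_K]%SET]) A i @^-1` B i.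
  apply/seteqP; split => [w [wU [wV wO]] i _|w wB].
    have [->|ij] := eqVneq i j; first by rewrite Bj.
    have [->|ik] := eqVneq i k; first by rewrite Bk.
    have io : i \in (~: [set j; k])%SET by rewrite !inE negb_or ij ik.
    by rewrite Bo; [exact: wO|rewrite -finset.in_setC].
  split; first by rewrite -Bj; apply: wB; rewrite /= finset.in_setT.
  split; first by rewrite -Bk; apply: wB; rewrite /= finset.in_setT.
  move=> i /=; rewrite finset.in_setC => io.
  have : B i (A i w) by apply: wB; rewrite /= finset.in_setT.
  by rewrite Bo.
rewrite indep (big_setD1 j) ?finset.in_setT//= (big_setD1 k) /=; last first.
  by rewrite !inE eq_sym jk.
rewrite Bj Bk /others_at_least indep; congr (_ * (_ * _))%E.
apply: eq_big => [i|i]; first by rewrite !inE negb_or andbT andbC.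
by rewrite !inE andbT => /andP[ik ij]; rewrite Bo// !inE negb_or ij ik.
Qed.

Lemma probability_uniquely_least_fiber e j k m l : j != k ->
  P (uniquely_least e j `&` (A j @^-1` [set m] `&` A k @^-1` [set l])) =
  (P (A j @^-1` [set m]) * (P (A k @^-1` [set l]) *
    (if (m + e < l)%N then P (others_at_least j k (m + e).+1) else 0)))%E.
Proof.
move=> jk; case: ifPn => [mel|]; last first.
  rewrite -leqNgt => lme; rewrite !mule0.
  rewrite (_ : _ `&` _ = set0) ?measure0//; apply/seteqP; split => // w.
  move=> [/(_ k)]; rewrite eq_sym => /(_ jk) /[swap] -[/= -> ->].
  by rewrite ltnNge lme.
rewrite -probability_split2//; congr (P _); apply/seteqP; split => w.
  move=> [lw [/= Aj Ak]]; split => //; split => // i /=.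
  by rewrite !inE negb_or => /andP[ij _]; have := lw i ij; rewrite Aj.
move=> [/= Aj [/= Ak lw]]; split => // i ij; rewrite Aj.
have [->|ik] := eqVneq i k; first by rewrite Ak.
by apply: lw; rewrite /= !inE negb_or ij ik.
Qed.

(** The conditional probability that a vote averts the penalty of [j], given
    [m] votes in [j] and [l] votes in [k]: the least of [l] and the votes of
    the remaining groups must equal [m + 1].  Neither the law of [A j] nor that
    of [A k] enters, whence the symmetry [aversion_weightC]. *)
Definition aversion_weight j k m l : R :=
  (if (m < l)%N then fine (P (others_at_least j k m.+1)) else 0) -
  (if (m.+1 < l)%N then fine (P (others_at_least j k m.+2)) else 0).

Lemma aversion_weightC j k m l : aversion_weight j k m l = aversion_weight k j m l.
Proof. by rewrite /aversion_weight /others_at_least finset.setUC. Qed.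

Lemma aversion_weight_ge0 j k m l : 0 <= aversion_weight j k m l.
Proof.
rewrite /aversion_weight; have [ml|_] := ltnP m.+1 l; last first.
  by rewrite subr0; case: ifP => // _; rewrite fine_ge0.
rewrite (ltnW ml) subr_ge0 fine_le ?fin_num_measure//.
apply: le_measure; rewrite ?inE//.
by move=> w ow i /ow /=; apply: ltnW.
Qed.

Lemma aversion_weight_eq0 j k m l : (l <= m)%N -> aversion_weight j k m l = 0.
Proof.
by move=> lm; rewrite /aversion_weight !ltnNge lm (leq_trans lm)// subr0.
Qed.

Lemma probability_averts_penalty_fiber j k m l : j != k ->
  P (averts_penalty j `&` (A j @^-1` [set m] `&` A k @^-1` [set l])) =
  (fine (P (A j @^-1` [set m])) * fine (P (A k @^-1` [set l])) *
   aversion_weight j k m l)%:E.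
Proof.
move=> jk; set S := _ `&` A k @^-1` _.
have mS : measurable S by exact: measurableI.
have -> : averts_penalty j `&` S =
    (uniquely_least 0 j `&` S) `\` (uniquely_least 1 j `&` S).
  apply/seteqP; split => w.
    by move=> [[l0 l1] Sw]; split => // -[].
  by move=> [[l0 Sw] l1]; split => //; split => // l1'; apply: l1.
have m0 e : measurable (uniquely_least e j `&` S) by exact: measurableI.
have l10 : uniquely_least 1 j `&` S `<=` uniquely_least 0 j `&` S.
  by move=> w [l1 Sw]; split => //; exact: uniquely_least_decr.
transitivity (P (uniquely_least 0 j `&` S) - P (uniquely_least 1 j `&` S))%E.
  rewrite measureD//; last by rewrite -ge0_fin_numE ?fin_num_measure.
  by rewrite (setIidr l10).
rewrite !probability_uniquely_least_fiber// addn0 addn1 /aversion_weight.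
rewrite -[P (A j @^-1` _)]fineK ?fin_num_measure//.
rewrite -[P (A k @^-1` _)]fineK ?fin_num_measure//.
rewrite -[P (others_at_least j k m.+1)]fineK ?fin_num_measure//.
rewrite -[P (others_at_least j k m.+2)]fineK ?fin_num_measure//.
by case: ifP => _; case: ifP => _; rewrite -?EFinM -?EFinB /= ?mule0;
  rewrite -?EFinM -?EFinB; congr EFin; ring.
Qed.

(** A group that is uniquely least leaves at least one vote to every other
    group, so a vote of [k] can avert the penalty only inside this event. *)
Lemma others_at_least_gt0 j k : j != k ->
  (0 < P (averts_penalty k))%E -> 0 < fine (P (others_at_least j k 1)).
Proof.
move=> jk Pk; rewrite fine_gt0// ltey_eq fin_num_measure// andbT.
apply: (lt_le_trans Pk); apply: le_measure; rewrite ?inE//.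
move=> w [lw _] i /=; rewrite !inE negb_or => /andP[_ ik].
by apply: leq_ltn_trans (lw i ik).
Qed.

End pivot.

(** * Poisson votes: smaller groups gain more from voting *)

Section poisson_pivot.
Context {d : measure_display} {T : measurableType d} {R : realType}.
Variables (P : probability T R) (K : nat) (n p : 'I_K -> R).
Variable A : 'I_K -> {RV P >-> nat}.
Hypothesis hA : poisson_votes n p A.

Local Open Scope classical_set_scope.

Lemma probability_votes k m : 0 < n k * p k ->
  fine (P (A k @^-1` [set m])) = poisson_pmf (n k * p k) m.
Proof.
move=> lam0; have := hA.1 k [set m]; rewrite poisson_prob_set1// => h.
by rewrite -[RHS]/(fine (poisson_pmf (n k * p k) m)%:E) -h.
Qed.

(** No vote count lies strictly below zero, so [k] is almost surely
    not the uniquely least supportive group, whatever it does. *)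
Lemma averts_penalty_support j k : j != k -> p j = 0 ->
  P (averts_penalty A k) = 0%E.
Proof.
move=> jk pj0; apply/eqP; rewrite eq_le measure_ge0 andbT.
have <- : P (A j @^-1` [set x | (0 < x)%N]) = 0%E.
  have := hA.1 j [set x | (0 < x)%N].
  rewrite /poisson_prob pj0 mulr0 ltxx /distribution /pushforward => ->.
  by rewrite diracE memNset.
apply: le_measure; rewrite ?inE; [exact: measurable_averts_penalty|exact: measurable_votes|].
by move=> w [lw _]; apply: leq_ltn_trans (lw j jk).
Qed.

(** The cell where [k] has [m] votes and [j] has [l] is compared with the one
    where [j] has [m] votes and [k] has [l]: both carry the same weight, and
    the Poisson masses favor the second. *)
Lemma averts_penalty_lt j k :
  0 < n j * p j -> n j * p j < n k * p k ->
  (0 < P (averts_penalty A k))%E ->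
  (P (averts_penalty A k) < P (averts_penalty A j))%E.
Proof.
move=> lj ljk Pk; have lk := lt_trans lj ljk.
have jk : j != k by apply/eqP => jk; move: ljk; rewrite jk ltxx.
have kj : k != j by rewrite eq_sym.
(* Codes of pairs index the cells by [nat], as countable additivity wants;
   the codes outside the image of [pickle] give empty cells. *)
pose X k j w := pickle (A k w, A j w).
have Xfiber k' j' m l : X k' j' @^-1` [set pickle (m, l)] =
    A k' @^-1` [set m] `&` A j' @^-1` [set l].
  apply/seteqP; split => [w /= /(pcan_inj pickleK) [Am Al]//|w /= [Am Al]].
  by rewrite /X Am Al.
have Xempty k' j' N : ~ (exists ml : nat * nat, N = pickle ml) ->
    X k' j' @^-1` [set N] = set0.
  move=> nN; apply/seteqP; split => // w /= XN; apply: nN.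
  by exists (A k' w, A j' w).
have mX k' j' N : measurable (averts_penalty A k' `&` X k' j' @^-1` [set N]).
  have [[[m l] ->]|/Xempty ->] := pselect (exists ml : nat * nat, N = pickle ml).
    rewrite Xfiber; apply: measurableI; first exact: measurable_averts_penalty.
    by apply: measurableI; exact: measurable_votes.
  by rewrite setI0.
have le_cell N : (P (averts_penalty A k `&` X k j @^-1` [set N]) <=
                  P (averts_penalty A j `&` X j k @^-1` [set N]))%E.
  have [[[m l] ->]|nN] := pselect (exists ml : nat * nat, N = pickle ml); last first.
    by rewrite !Xempty// !setI0.
  rewrite !Xfiber !probability_averts_penalty_fiber//; [|exact: hA.2|exact: hA.2].
  rewrite lee_fin !probability_votes// [aversion_weight A k j _ _]aversion_weightC.
  have [lm|/ltnW ml] := leqP l m; first by rewrite aversion_weight_eq0 ?mulr0.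
  by rewrite ler_wpM2r ?aversion_weight_ge0 ?poisson_pmf_swap// ltW.
(* The strict cell: no vote in the endangered group, one in its rival. *)
pose N0 := pickle (0%N, 1%N).
have lt_cell : (P (averts_penalty A k `&` X k j @^-1` [set N0]) <
                P (averts_penalty A j `&` X j k @^-1` [set N0]))%E.
  rewrite !Xfiber !probability_averts_penalty_fiber//; [|exact: hA.2|exact: hA.2].
  rewrite lte_fin !probability_votes// [aversion_weight A k j _ _]aversion_weightC.
  rewrite ltr_pM2r ?poisson_pmf_swap01//.
  by rewrite /aversion_weight /= subr0 others_at_least_gt0.
exact: (lt_measure_fibers (mX k j) (mX j k) le_cell lt_cell).
Qed.

End poisson_pivot.

(** * Equilibria *)

Theorem proposition8 (R : realType) (K : nat) (n : 'I_K -> R) (chiA c : R)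
    (p q : 'I_K -> R)
    (d : measure_display) (T : measurableType d) (P : probability T R)
    (A : 'I_K -> {RV P >-> nat})
    (hK : (2 <= K)%N)
    (hn : forall k : 'I_K, 0 < n k)
    (hchiA : 0 < chiA)
    (hc : 0 < c)
    (hA : poisson_votes n p A)
    (hNash : nash_equilibrium chiA c A p q) :
  (forall i : 'I_K, p i = 0) \/
  ((forall i : 'I_K, 0 < p i) /\
   (forall j : 'I_K,
      p j * n j = max_mean n p \/ (n j < max_mean n p /\ p j = 1))).
Proof.
case: hNash => play_ge0 best.
pose D k := fine (P (averts_penalty A k)).
have p_ge0 k : 0 <= p k := play_ge0 k VoteA.
have DE k : - chiA * penalty_pivot A k = chiA * D k.
  by rewrite /D probability_averts_penalty mulrN mulNr.
have q0 k : q k = 0.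
  apply/eqP; rewrite eq_le (play_ge0 k VoteB) andbT leNgt; apply/negP => qk.
  by have := best k VoteB qk Abstain; rewrite /= leNgt oppr_lt0 hc.
have vote k : 0 < p k -> c <= chiA * D k.
  by move=> pk; have := best k VoteA pk Abstain; rewrite /= DE subr_ge0.
have mix k : p k < 1 -> chiA * D k <= c.
  move=> pk; have := best k Abstain _ VoteA.
  by rewrite /= DE q0 subr0 subr_gt0 subr_le0; apply.
have D_gt0 k : 0 < p k -> (0 < P (averts_penalty A k))%E.
  move=> pk; rewrite lt0e measure_ge0 andbT; apply/eqP => P0.
  by have := vote k pk; rewrite /D P0 mulr0 leNgt hc.
have [all0|/existsNP[k /eqP pk0]] := pselect (forall i, p i = 0); [by left|right].
have pk : 0 < p k by rewrite lt0r pk0 p_ge0.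
have p_gt0 i : 0 < p i.
  rewrite lt0r p_ge0 andbT; apply/eqP => pi0.
  have ik : i != k by apply: contraNneq pk0 => <-; rewrite pi0.
  by have := D_gt0 k pk; rewrite (averts_penalty_support hA ik pi0) ltxx.
split => // j.
have lam_gt0 i : 0 < n i * p i by rewrite mulr_gt0.
have [i0 _ maxE] : {i0 | i0 \in predT & max_mean n p = n i0 * p i0}.
  by apply: (eq_bigmax k) => // i _; exact: ltW.
have := le_bigmax 0 (fun i => n i * p i) j.
rewrite -/(max_mean n p) le_eqVlt => /orP[/eqP <-|]; first by left; rewrite mulrC.
move=> jmax; right.
have pj1 : p j = 1.
  apply/eqP; rewrite eq_le; apply/andP; split.
    by have := play_ge0 j Abstain; rewrite /= q0 subr0 subr_ge0.
  rewrite leNgt; apply/negP => pj1.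
  have /(averts_penalty_lt hA (lam_gt0 j)) : n j * p j < n i0 * p i0.
    by rewrite -maxE.
  move=> /(_ (D_gt0 _ (p_gt0 i0))).
  rewrite -[X in (X < _)%E]fineK ?fin_num_measure//; last exact: measurable_averts_penalty.
  rewrite -[X in (_ < X)%E]fineK ?fin_num_measure//; last exact: measurable_averts_penalty.
  rewrite lte_fin -/(D i0) -/(D j) -(ltr_pM2l hchiA) ltNge.
  by rewrite (le_trans (mix j pj1) (vote i0 (p_gt0 i0))).
by split => //; move: jmax; rewrite pj1 mulr1.
Qed.
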